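(* For every totally real number field $K$, the number $$\kappa(K)=\max_{I}\kappa(I),$$ where $I$ runs over all nonzero fractional ideals of $\mathcal{O}_K$, is finite.
   Context: Let $K$ be a totally real number field with ring of integers $\mathcal{O}_K$. An element of $K$ is totally positive if all its images under the real embeddings of $K$ are positive. For a subset $J\subseteq K$, $J^+$ is the set of totally positive elements of $J$, and $J^{+,0}=J^+\cup\{0\}$. For a nonzero fractional ideal $I$ of $\mathcal{O}_K$, $\kappa(I)$ is the smallest number $n$ such that there exist $\alpha_1,\dots,\alpha_n\in K^+$ with $$I^{+,0}=\alpha_1\mathcal{O}_K^{+,0}+\dots+\alpha_n\mathcal{O}_K^{+,0}$$ (a priori $\kappa(I)=\infty$ if no such $n$ exists, and the maximum defining $\kappa(K)$ is a priori a supremum in $\mathbb{N}\cup\{\infty\}$). *)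

(* Defs.v *)
From HB Require Import structures.
From mathcomp Require Import all_boot all_order all_algebra all_field.
From mathcomp Require Import complex.
From mathcomp Require Import classical_sets reals constructive_ereal ereal.
Set Implicit Arguments.
Unset Strict Implicit.
Unset Printing Implicit Defensive.
Import Order.TTheory GRing.Theory Num.Theory.
Local Open Scope classical_set_scope.
Local Open Scope ring_scope.

(* A number field is a [K : fieldExtType rat] (finite-dimensional over rat); *)
(* [R : realType] is the field of real numbers and [R[i]] that of complex    *)
(* numbers. Field embeddings are ring morphisms.                             *)

Definition totally_real (R : realType) (K : fieldExtType rat) : Prop :=
  forall (s : {rmorphism K -> R[i]}) (x : K), complex.Im (s x) = 0.

Definition totally_positive (R : realType) (K : fieldExtType rat) (x : K) :
    Prop :=
  forall s : {rmorphism K -> R}, 0 < s x.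

Definition pos_part (R : realType) (K : fieldExtType rat) (J : set K) :
    set K :=
  J `&` [set x | totally_positive R x].

Definition pos0_part (R : realType) (K : fieldExtType rat) (J : set K) :
    set K :=
  pos_part R J `|` [set 0].

Definition ring_of_integers (K : fieldExtType rat) : set K :=
  [set x | integralOver (intr : int -> K) x].

Record fractional_ideal (K : fieldExtType rat) (I : set K) : Prop :=
  FractionalIdeal {
    frac0 : I 0;
    fracD : forall x y, I x -> I y -> I (x + y);
    fracM : forall a x, ring_of_integers a -> I x -> I (a * x);
    frac_denom : exists d : K,
      [/\ ring_of_integers d, d != 0
        & forall x, I x -> ring_of_integers (d * x)]
  }.

Definition nonzero_fractional_ideal (K : fieldExtType rat) (I : set K) : Prop :=
  fractional_ideal I /\ exists2 x, I x & x != 0.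

(* alpha_1 O^{+,0} + ... + alpha_n O^{+,0}, with O the ring of integers. *)
Definition pos0_span (R : realType) (K : fieldExtType rat) (n : nat)
    (alpha : 'I_n -> K) : set K :=
  [set x | exists g : 'I_n -> K,
     (forall i, pos0_part R (@ring_of_integers K) (g i)) /\
     x = \sum_(i < n) alpha i * g i].

Definition pos0_generated_by (R : realType) (K : fieldExtType rat) (I : set K)
    (n : nat) : Prop :=
  exists alpha : 'I_n -> K,
    (forall i, pos_part R [set: K] (alpha i)) /\
    pos0_part R I = pos0_span R alpha.

(* The infimum of a nonempty set of natural numbers is its least element,    *)
(* and that of the empty set is +oo.                                         *)
Definition kappa (R : realType) (K : fieldExtType rat) (I : set K) : \bar R :=
  ereal_inf [set (n%:R : R)%:E | n in [set n | pos0_generated_by R I n]].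

(* When finite, this supremum of natural numbers is a maximum. *)
Definition kappa_field (R : realType) (K : fieldExtType rat) : \bar R :=
  ereal_sup [set kappa R I | I in [set I : set K | nonzero_fractional_ideal I]].

(* Main.v *)
(* The narrow class group and the unit theorem are not needed. For a nonzero
   fractional ideal [I], take a totally positive [b] in [I] with [M I] contained
   in [b O], where [M] depends on [K] only: choose a nonzero element of [I] of
   least norm, use the Dirichlet-Hurwitz approximation "some [k x] with [k <= M]
   is within norm 1 of an integer", and correct the signs by one of finitely
   many integers. By Minkowski's theorem on a box, a totally positive [x] in [I]
   with [N (x / b)] large dominates some [b g ^+ 2] with [g] a nonzero integer,
   and [x - b g ^+ 2] is again totally positive, so that a descent on the norm
   leaves [x] with [N (M x / b) <= B], where [B] depends on [K] only. Two
   totally positive integers of norm at most [B] that are congruent modulo [B!]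
   have an integral quotient, so [b] together with one [x] for each residue class
   of [M x / b] modulo [B!] generates [I^{+,0}]. *)
Require Import Defs.
From HB Require Import structures.
From mathcomp Require Import all_boot all_order all_algebra all_field.
From mathcomp Require Import complex.
From mathcomp Require Import classical_sets reals constructive_ereal ereal.
From mathcomp Require Import boolp ring lra.
Set Implicit Arguments.
Unset Strict Implicit.
Unset Printing Implicit Defensive.
Import Order.TTheory GRing.Theory Num.Theory.
Local Open Scope ring_scope.

(** * Primitive elements and embeddings of a number field *)

Lemma primitive_element_rat (K : fieldExtType rat) :
  exists t : K, <<1; t>>%VS = fullv.
Proof.
have pchK : [pchar K] =i pred0 by move=> p; rewrite pchar_lalg pchar_num.
have sepK : separable 1 {:K}%AS by apply/separableP=> u _; exact: pcharf0_separable.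
exists (separable_generator 1 {:K}%AS).
by rewrite -eq_adjoin_separable_generator ?sub1v.
Qed.

Lemma minimal_polynomial_rat (K : fieldExtType rat) (t : K) :
  exists m : {poly rat},
    [/\ m \is monic, root (map_poly (in_alg K) m) t,
        forall p, root (map_poly (in_alg K) p) t -> m %| p
      & separable_poly m].
Proof.
have pchK : [pchar K] =i pred0 by move=> p; rewrite pchar_lalg pchar_num.
have /polyOver1P[m mE] := minPolyOver 1 t.
exists m; split.
- by rewrite -(map_monic (in_alg K)) -mE monic_minPoly.
- by rewrite -mE root_minPoly.
- move=> p pt; rewrite -(dvdp_map (in_alg K)) -mE minPoly_dvdp //.
  by apply/polyOver1P; exists p.
- rewrite -(separable_map (in_alg K)) -mE.
  exact: pcharf0_separable.
Qed.

Lemma rat_polynomial_generator (K : fieldExtType rat) (t x : K) :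
  <<1; t>>%VS = fullv -> exists p, x = (map_poly (in_alg K) p).[t].
Proof. by move=> tK; apply/Fadjoin1_polyP; rewrite tK memvf. Qed.

Lemma rmorph_horner_rat (K : fieldExtType rat) (F : numFieldType)
    (s : {rmorphism K -> F}) (p : {poly rat}) (t : K) :
  s (map_poly (in_alg K) p).[t] = (map_poly ratr p).[s t].
Proof.
rewrite -horner_map -map_poly_comp; congr (_ .[_]).
by apply: eq_map_poly; exact: (fmorph_eq_rat (s \o in_alg K)).
Qed.

(** The map sends [p(t)] to [p(r)]. Two polynomials with the same value at [t] differ by a multiple
    of [m], which vanishes at [r]. *)
Lemma embedding_of_root (K : fieldExtType rat) (F : numFieldType) (t : K)
    (m : {poly rat}) (r : F) :
    <<1; t>>%VS = fullv ->
    (forall p, root (map_poly (in_alg K) p) t -> m %| p) ->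
    root (map_poly ratr m) r ->
  exists s : {rmorphism K -> F}, s t = r.
Proof.
move=> tK mmin rm.
have [q qE] := choice (fun x => rat_polynomial_generator x tK).
pose s x : F := (map_poly ratr (q x)).[r].
have sE p : s (map_poly (in_alg K) p).[t] = (map_poly ratr p).[r].
  apply/eqP; rewrite -subr_eq0 -hornerN -hornerD -rmorphB /=.
  set u := q _ - p.
  have /dvdpP[w ->] : m %| u.
    by apply: mmin; rewrite rootE rmorphB hornerD hornerN /= -qE subrr.
  by rewrite rmorphM hornerM (rootP rm) mulr0.
have sB : zmod_morphism s.
  move=> x y; rewrite {1}(qE x) {1}(qE y) -hornerN -hornerD -rmorphB sE.
  by rewrite rmorphB hornerD hornerN.
have sM : monoid_morphism s.
  split=> [|x y].
    have -> : 1 = (map_poly (in_alg K) 1%:P).[t].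
      by rewrite map_polyC hornerC /= scale1r.
    by rewrite sE map_polyC hornerC; exact: rmorph1.
  by rewrite {1}(qE x) {1}(qE y) -hornerM -rmorphM sE rmorphM hornerM.
pose sb := GRing.isZmodMorphism.Build _ _ s sB.
pose sm := GRing.isMonoidMorphism.Build _ _ s sM.
pose sr : {rmorphism K -> F} := HB.pack s sb sm.
exists sr; have -> : t = (map_poly (in_alg K) 'X).[t] by rewrite map_polyX hornerX.
by rewrite [LHS]sE map_polyX hornerX.
Qed.

Lemma integral_multiple (K : fieldExtType rat) (x : K) :
  exists2 a : int, a != 0 & integralOver (intr : int -> K) (a%:~R * x).
Proof.
have [m [mmon mx _ _]] := minimal_polynomial_rat x.
have [q [a a0 mE]] := rat_poly_scale m.
exists a => //.
(* With [a] clearing the denominators of [m], of degree n, [a x] is a root of the monic polynomial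
   with coefficients m_i a^(n - i). The leading one is set apart: at i = n the truncated exponent
   would leave [a] instead of 1. *)
pose c i : K := if i == (size m).-1 then 1 else
  in_alg K (m`_i * a%:~R) * a%:~R ^+ ((size m).-1 - i).-1.
have aK : a%:~R != 0 :> K.
  by rewrite -(rmorph_int (in_alg K)) fmorph_eq0 intr_eq0.
have cE i : (i < size m)%N ->
    c i = in_alg K m`_i * a%:~R ^+ ((size m).-1 - i).
  rewrite -[size m]prednK ?size_poly_gt0 ?monic_neq0 // ltnS /c leq_eqVlt.
  case: eqP => [-> _|_ im].
    by rewrite subnn mulr1 -lead_coefE (monicP mmon) /= scale1r.
  rewrite (rmorphM (in_alg K)) (rmorph_int (in_alg K)) -mulrA -exprS prednK ?subn_gt0 //.
pose p := \poly_(i < size m) c i.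
have sm : size m = (size m).-1.+1 by rewrite prednK ?size_poly_gt0 ?monic_neq0.
have sp : size p = size m.
  by rewrite size_poly_eq // /c eqxx oner_eq0.
apply: (@integral_root_monic _ _ _ _ p).
- by rewrite monicE lead_coefE sp coef_poly {2}sm ltnSn /c eqxx.
- rewrite rootE horner_poly.
  have : a%:~R ^+ (size m).-1 * (map_poly (in_alg K) m).[x] = 0.
    by rewrite (rootP mx) mulr0.
  rewrite (@horner_coef_wide _ (size m)) ?size_map_poly // mulr_sumr => h.
  apply/eqP; rewrite -[RHS]h; apply: eq_bigr => i _.
  rewrite cE // coef_map /= exprMn.
  have -> : (size m).-1 = (i + ((size m).-1 - i))%N.
    by rewrite subnKC // -ltnS -sm.
  by rewrite exprD (addnC i) addnK; ring.
- apply/integral_poly => i; rewrite coef_poly; case: ifP => [im|_]; last first.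
    exact: integral0.
  rewrite /c; case: ifP => _; first exact: integral1.
  have -> : m`_i * a%:~R = (q`_i)%:~R.
    by rewrite mE coefZ coef_map /= mulrC mulrA divff ?mul1r ?intr_eq0.
  rewrite (rmorph_int (in_alg K)) -rmorphXn -rmorphM.
  exact: integral_id.
Qed.

Lemma integral_primitive_element (K : fieldExtType rat) :
  exists2 t : K, integralOver (intr : int -> K) t & <<1; t>>%VS = fullv.
Proof.
have [t tK] := primitive_element_rat K.
have [a a0 at_int] := integral_multiple t.
exists (a%:~R * t) => //.
have aK : a%:~R != 0 :> K.
  by rewrite -(rmorph_int (in_alg K)) fmorph_eq0 intr_eq0.
apply/eqP; rewrite eqEsubv subvf /= -tK; apply/FadjoinP; split; first exact: sub1v.
have tE : t = (a%:~R : rat)^-1 *: (a%:~R * t).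
  by rewrite -(rmorph_int (in_alg K)) mulr_algl scalerA mulVf ?intr_eq0 // scale1r.
by rewrite [in X in X \in _]tE; apply: memvZ; apply: memv_adjoin.
Qed.

(** Each complex root of the minimal polynomial of [t] comes from an embedding into [R[i]], hence is
    real by hypothesis and yields a real embedding. The roots are distinct by separability, and
    [d.+1] is the degree, so reduction modulo [m] leaves only the powers up to [d]. *)
Lemma real_embeddings (R : realType) (K : fieldExtType rat) :
    totally_real R K ->
  exists d (t : K) (sigma : 'I_d.+1 -> {rmorphism K -> R}),
    [/\ integralOver (intr : int -> K) t,
        forall x, exists q : 'I_d.+1 -> rat, x = \sum_i q i *: t ^+ i,
        injective (fun j => sigma j t)
      & forall s : {rmorphism K -> R}, exists j, s =1 sigma j].
Proof.
move=> Kreal.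
have [t tint tK] := integral_primitive_element K.
have [m [mmon mt mmin msep]] := minimal_polynomial_rat t.
have [rs rsE] := closed_field_poly_normal (map_poly ratr m : {poly R[i]}).
have /monicP rmon : map_poly ratr m \is @monic R[i] by rewrite map_monic.
rewrite rmon scale1r in rsE.
have rsU : uniq rs.
  by rewrite -separable_prod_XsubC -rsE separable_map.
have szrs : (size rs).+1 = size m.
  by rewrite -(size_prod_XsubC _ id) -rsE size_map_poly.
(* Without roots [m] would be a nonzero constant and could not vanish at [t]; this justifies the
   index type ['I_d.+1]. *)
case: (posnP (size rs)) => [rs0|rs_gt0].
  move: mt; have /size_poly1P[c c0 ->] : size m == 1 by rewrite -szrs rs0.
  by rewrite map_polyC rootC fmorph_eq0 (negPf c0).
exists (size rs).-1, t; rewrite prednK //.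
have rootE (r : R) : root (map_poly ratr m) r = (r%:C%C \in rs).
  rewrite -root_prod_XsubC -rsE -(fmorph_root (real_complex R)) -map_poly_comp.
  by congr root; apply: eq_map_poly => x; exact: (fmorph_eq_rat (real_complex R \o ratr)) x.
have /fin_all_exists[sigma sigmaE] (j : 'I_(size rs)) :
    exists s : {rmorphism K -> R}, (s t)%:C%C = rs`_j.
  have rj : root (map_poly ratr m) rs`_j.
    by rewrite rsE root_prod_XsubC mem_nth.
  have [u ut] := embedding_of_root tK mmin rj.
  have rjE : (complex.Re rs`_j)%:C%C = rs`_j.
    by move: (Kreal u t); rewrite ut; case: (rs`_j) => a b /= ->.
  have : root (map_poly ratr m) (complex.Re rs`_j).
    by rewrite rootE rjE mem_nth.
  move/(embedding_of_root tK mmin) => [s st]; exists s.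
  by rewrite st.
exists sigma; split => //.
- move=> x; have [p xE] := rat_polynomial_generator x tK.
  have [q [qE qsz]] : exists q : {poly rat},
      x = (map_poly (in_alg K) q).[t] /\ (size q <= size rs)%N.
    exists (p %% m); split.
      rewrite xE {1}(divp_eq p m) rmorphD rmorphM hornerD hornerM (rootP mt).
      by rewrite mulr0 add0r.
    by rewrite -ltnS szrs ltn_modp monic_neq0.
  exists (fun i => q`_i); rewrite qE (@horner_coef_wide _ (size rs)) ?size_map_poly //.
  by apply: eq_bigr => i _; rewrite coef_map /= mulr_algl.
- move=> j k /(congr1 (real_complex R)) /=; rewrite !sigmaE => /eqP.
  by rewrite nth_uniq // => /eqP/val_inj.
- move=> s.
  have /(nthP 0)[j jlt jE] : (s t)%:C%C \in rs.
    by rewrite -rootE /root -rmorph_horner_rat (rootP mt) rmorph0.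
  exists (Ordinal jlt) => x.
  have [p ->] := rat_polynomial_generator x tK.
  rewrite !rmorph_horner_rat; congr (_.[_]).
  by apply: (fmorph_inj (real_complex R)); rewrite /= sigmaE.
Qed.

(** * Algebraic integers *)

Lemma integral_fmorph (F L : fieldType) (f : {rmorphism F -> L}) (x : F) :
  integralOver (intr : int -> L) (f x) <-> integralOver (intr : int -> F) x.
Proof.
have fE p : map_poly (intr : int -> L) p = map_poly f (map_poly intr p).
  by rewrite -map_poly_comp; apply: eq_map_poly => z /=; rewrite rmorph_int.
split=> -[p pmon px]; exists p => //; last by rewrite fE fmorph_root.
by rewrite fE fmorph_root in px.
Qed.

(** Transfer to [algC], where a rational algebraic integer is an integer. *)
Lemma integral_rat_int (q : rat) :
  integralOver (intr : int -> rat) q -> exists z : int, q = z%:~R.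
Proof.
move=> /(integral_fmorph (@ratr algC)) [p pmon pq].
have qA : ratr q \in Aint.
  apply: (root_monic_Aint pq); first exact: monic_map.
  by apply/polyOverP => i; rewrite coef_map /= intr_int.
have /intrP[z zE] := Cint_rat_Aint (Crat_rat q) qA.
by exists z; apply: (fmorph_inj (@ratr algC)); rewrite [LHS]zE; apply/esym/rmorph_int.
Qed.

Lemma integral_prod (F : fieldType) (I : finType) (P : pred I) (f : I -> F) :
    (forall i, P i -> integralOver (intr : int -> F) (f i)) ->
  integralOver (intr : int -> F) (\prod_(i | P i) f i).
Proof.
move=> fint; apply: (big_ind _ _ _ fint); first exact: integral1.
exact: integral_mul.
Qed.

Lemma integral_sum (F : fieldType) (I : finType) (P : pred I) (f : I -> F) :
    (forall i, P i -> integralOver (intr : int -> F) (f i)) ->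
  integralOver (intr : int -> F) (\sum_(i | P i) f i).
Proof.
move=> fint; apply: (big_ind _ _ _ fint); first exact: integral0.
exact: integral_add.
Qed.

Lemma integral_exp (F : fieldType) (x : F) n :
  integralOver (intr : int -> F) x -> integralOver (intr : int -> F) (x ^+ n).
Proof.
move=> xint; rewrite -[n]card_ord -prodr_const.
by apply: integral_prod => i _.
Qed.

(** When [sigma] lists all real embeddings of a totally real [K], this is the field norm over the
    rationals, with values in [R]. *)
Definition embedding_norm (R : realType) (K : fieldExtType rat) (d : nat)
  (sigma : 'I_d.+1 -> {rmorphism K -> R}) (x : K) : R := \prod_j sigma j x.

Lemma pigeonhole (T U : finType) (f : T -> U) :
  (#|U| < #|T|)%N -> exists x y, x != y /\ f x = f y.
Proof.
move=> UT; have : ~~ injectiveb f.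
  by apply/injectiveP => /leq_card; rewrite leqNgt UT.
by move=> /injectivePn[x [y xy fxy]]; exists x, y.
Qed.

(** * Norms in a totally real field *)

Section TotallyRealField.

Variables (R : realType) (K : fieldExtType rat) (d : nat) (t : K).
Variable sigma : 'I_d.+1 -> {rmorphism K -> R}.
Hypothesis t_int : integralOver (intr : int -> K) t.
Hypothesis t_gen :
  forall x : K, exists q : 'I_d.+1 -> rat, x = \sum_i q i *: t ^+ i.
Hypothesis sigma_inj : injective (fun j => sigma j t).
Hypothesis sigma_all : forall s : {rmorphism K -> R}, exists j, s =1 sigma j.

Local Notation integral := (integralOver (intr : int -> K)).
Local Notation N := (embedding_norm sigma).
Local Notation tp := (@totally_positive R K).

Lemma embedding_scale (q : rat) (x : K) j : sigma j (q *: x) = ratr q * sigma j x.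
Proof.
rewrite -mulr_algl rmorphM; congr (_ * _).
exact: (fmorph_eq_rat (sigma j \o in_alg K)).
Qed.

Lemma embedding_normM x y : N (x * y) = N x * N y.
Proof. by rewrite -big_split; apply: eq_bigr => j _; rewrite rmorphM. Qed.

Lemma embedding_norm_eq0 x : (N x == 0) = (x == 0).
Proof.
apply/idP/eqP => [/prodf_eq0[j _]|->]; first by rewrite fmorph_eq0 => /eqP.
by apply/prodf_eq0; exists ord0; rewrite ?rmorph0.
Qed.

Lemma embedding_norm_nat n : N n%:R = n%:R ^+ d.+1.
Proof.
by rewrite /N (eq_bigr (fun=> n%:R)) ?prodr_const ?card_ord // => j _; rewrite rmorph_nat.
Qed.

(* Multiplication by [x] has a rational matrix [A] on the basis [t ^+ i], and
   the Vandermonde matrix of the conjugates of [t] diagonalizes it, with the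
   conjugates of [x] as eigenvalues. *)
Lemma embedding_norm_rat x : exists q : rat, N x = ratr q.
Proof.
have [A AE] := choice (fun i : 'I_d.+1 => t_gen (x * t ^+ i)).
exists (\det (\matrix_(i, j) A i j)).
pose V := Vandermonde d.+1 (\row_j sigma j t).
have V0 : \det V != 0.
  rewrite det_Vandermonde; apply/prodf_neq0 => i _; apply/prodf_neq0 => j ij.
  rewrite !mxE subr_eq0; apply/eqP => /sigma_inj jiE.
  by rewrite jiE ltnn in ij.
apply: (mulIf V0).
have : map_mx ratr (\matrix_(i, j) A i j) *m V = V *m diag_mx (\row_j sigma j x).
  apply/matrixP => i j; rewrite mul_mx_diag !mxE -rmorphXn -rmorphM mulrC AE.
  rewrite rmorph_sum; apply: eq_bigr => k _.
  by rewrite !mxE embedding_scale rmorphXn.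
move/(congr1 determinant); rewrite !det_mulmx det_map_mx det_diag [RHS]mulrC.
by move=> ->; congr (_ * _); apply: eq_bigr => j _; rewrite mxE.
Qed.

(** The norm is rational as a determinant and integral as a product of conjugates. *)
Lemma embedding_norm_int x : integral x -> exists z : int, N x = z%:~R.
Proof.
move=> xint; have [q qE] := embedding_norm_rat x.
have : integralOver (intr : int -> R) (N x).
  by apply: integral_prod => j _; apply/integral_fmorph.
rewrite qE => /integral_fmorph/integral_rat_int[z ->].
by exists z; rewrite rmorph_int.
Qed.

Lemma embedding_norm_ge1 x : integral x -> x != 0 -> 1 <= `|N x|.
Proof.
move=> /embedding_norm_int[z zE]; rewrite -embedding_norm_eq0 zE intr_eq0 -intr_norm => z0.
by rewrite ler1z -gtz0_ge1 normr_gt0.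
Qed.

(** Under [sigma ord0] the quotient becomes the product of the other conjugates, which is integral
    in [R]; integrality is then pulled back to [K]. *)
Lemma integral_norm_div x (z : int) :
  integral x -> x != 0 -> N x = z%:~R -> integral (z%:~R / x).
Proof.
move=> xint x0 zE; apply/(integral_fmorph (sigma ord0)).
rewrite fmorph_div rmorph_int -zE /N /embedding_norm (bigD1 ord0) //= mulrAC.
rewrite divff ?fmorph_eq0 // mul1r.
by apply: integral_prod => j _; apply/integral_fmorph.
Qed.

(** * The order Z[t] and its geometry of numbers *)

Definition int_comb (a : 'I_d.+1 -> int) : K := \sum_i (a i)%:~R * t ^+ i.

Lemma integral_int_comb a : integral (int_comb a).
Proof.
apply: integral_sum => i _; apply: integral_mul; last exact: integral_exp.
exact: integral_id.
Qed.

(** The differences of coefficients form a polynomial of degree at most [d] that vanishes at the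
    [d.+1] distinct conjugates of [t]. *)
Lemma int_comb_inj a b : int_comb a = int_comb b -> a =1 b.
Proof.
move=> /eqP; rewrite -subr_eq0 -sumrB => /eqP ab0 i.
pose p : {poly R} := \poly_(i < d.+1) (a (inord i) - b (inord i))%:~R.
suff p0 : p = 0.
  have := congr1 (fun p : {poly R} => p`_i) p0.
  rewrite coef_poly ltn_ord coef0 inord_val => /eqP.
  by rewrite intr_eq0 subr_eq0 => /eqP.
apply: (@roots_geq_poly_eq0 _ _ [seq sigma j t | j : 'I_d.+1]).
- apply/allP => _ /mapP[j _ ->]; rewrite rootE horner_poly.
  apply/eqP; rewrite -[RHS](rmorph0 (sigma j)) -[X in _ = sigma j X]ab0.
  rewrite rmorph_sum; apply: eq_bigr => k _.
  by rewrite inord_val -mulrBl -rmorphB rmorphM rmorph_int rmorphXn.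
- by rewrite map_inj_uniq ?enum_uniq.
- by rewrite size_image card_ord size_poly.
Qed.

Lemma int_combE (a : 'I_d.+1 -> int) : int_comb a = \sum_i (a i)%:~R *: t ^+ i.
Proof. by apply: eq_bigr => i _; rewrite scaler_int mulrzl. Qed.

(** Lets the two pigeonhole arguments below pass from coordinates on the powers of [t] to
    conjugates. *)
Lemma conjugate_bound : exists2 S : R, 0 < S &
  forall (q : 'I_d.+1 -> rat) (e : R) j, (forall i, ratr `|q i| <= e) ->
    `|sigma j (\sum_i q i *: t ^+ i)| <= e * S.
Proof.
exists (1 + \sum_j \sum_(i < d.+1) `|sigma j t| ^+ i).
  by rewrite ltr_pwDl // sumr_ge0 // => j _; rewrite sumr_ge0 // => i _; rewrite exprn_ge0.
move=> q e j qe.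
have e0 : 0 <= e by apply: le_trans (qe ord0); rewrite ler0q.
rewrite rmorph_sum; apply: le_trans (ler_norm_sum _ _ _) _.
apply: (@le_trans _ _ (e * \sum_(i < d.+1) `|sigma j t| ^+ i)).
  rewrite mulr_sumr; apply: ler_sum => i _.
  rewrite embedding_scale normrM rmorphXn normrX ler_wpM2r ?exprn_ge0 //.
  apply: le_trans (qe i).
  by rewrite ratr_norm.
rewrite ler_wpM2l // [X in _ <= 1 + X](bigD1 j) //= addrCA lerDl addr_ge0 // sumr_ge0 // => k _.
by rewrite sumr_ge0 // => i _; rewrite exprn_ge0.
Qed.

(* Dirichlet approximation of the coordinates of [x] by rationals with a common
   denominator [k]: a Euclidean algorithm up to bounded multiples. *)
Lemma norm_approximation : exists2 M, (0 < M)%N &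
  forall x : K, exists k (a : 'I_d.+1 -> int), (0 < k <= M)%N /\ `|N (k%:R * x - int_comb a)| < 1.
Proof.
have [S S0 Sbound] := conjugate_bound.
have := archi_boundP (ltW S0); case: (Num.bound S) => [|m Sm].
  by rewrite ltNge (ltW S0).
(* The cube of fractional parts is cut into this many cubes of side 1 / [m.+1]. One more multiple of
   [x] is considered, so two of them share a cube; as [S < m.+1], their difference has all
   conjugates below 1 modulo Z[t]. *)
exists (m.+1 ^ d.+1)%N; first by rewrite expn_gt0.
move=> x; have [q xE] := t_gen x.
pose fr (k : nat) i : rat := k%:R * q i - (Num.floor (k%:R * q i))%:~R.
have fr_itv k i : 0 <= fr k i < 1.
  rewrite /fr; have /andP[h1 h2] := floor_itv (k%:R * q i).
  by rewrite subr_ge0 h1 /= ltrBlDl -[X in _ + X]/(1%:~R) -intrD.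
have mfr_ge0 k i : 0 <= m.+1%:R * fr k i.
  by have /andP[h _] := fr_itv k i; rewrite mulr_ge0.
pose box (k : 'I_(m.+1 ^ d.+1).+1) : {ffun 'I_d.+1 -> 'I_m.+1} :=
  [ffun i => inord (Num.truncn (m.+1%:R * fr k i))].
have boxE k i : box k i = Num.truncn (m.+1%:R * fr k i) :> nat.
  rewrite ffunE inordK // truncn_lt_nat // -[ltRHS]mulr1 ltr_pM2l //.
  by have /andP[] := fr_itv k i.
have [|k [l [kl bkl]]] := @pigeonhole _ _ box _.
  by rewrite card_ffun !card_ord.
wlog lt_kl : k l kl bkl / (k < l)%N.
  move=> h; case: (ltngtP k l) => kl'; [exact: (h k l)| |].
    by apply: (h l k) => //; rewrite eq_sym.
  by move: kl; rewrite -val_eqE /= kl' eqxx.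
exists (l - k)%N.
exists (fun i => Num.floor (l%:R * q i) - Num.floor (k%:R * q i)).
split.
  by rewrite subn_gt0 lt_kl /= (leq_trans (leq_subr _ _)) // -ltnS.
rewrite int_combE.
have -> : (l - k)%:R * x -
    \sum_(i < d.+1) (Num.floor (l%:R * q i) - Num.floor (k%:R * q i))%:~R *: t ^+ i =
    \sum_i (fr l i - fr k i) *: t ^+ i.
  rewrite xE mulr_sumr -sumrB; apply: eq_bigr => i _.
  rewrite mulr_natl -scaler_nat scalerA -scalerBl; congr (_ *: _).
  by rewrite /fr natrB ?(ltnW lt_kl) // rmorphB /=; ring.
have m0 : 0 < m.+1%:R :> R by rewrite ltr0n.
have Sj j : `|sigma j (\sum_i (fr l i - fr k i) *: t ^+ i)| <= S / m.+1%:R.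
  rewrite [leRHS]mulrC; apply: Sbound => i.
  rewrite -[m.+1%:R^-1](_ : ratr m.+1%:R^-1 = _); last first.
    by rewrite fmorphV rmorph_nat.
  rewrite ler_rat -[leRHS]mul1r ler_pdivlMr ?ltr0n //.
  have /andP[l1 l2] := truncn_itv (mfr_ge0 l i).
  have /andP[k1 k2] := truncn_itv (mfr_ge0 k i).
  rewrite -boxE bkl boxE in k1 k2.
  rewrite -[X in _ * X]ger0_norm ?ler0n // -normrM ler_norml.
  set T := Num.truncn (m.+1%:R * fr l i) in l1 l2 k1 k2.
  rewrite -[T.+1%:R]natr1 in l2 k2.
  by rewrite mulrC mulrBr; apply/andP; split; lra.
rewrite normr_prod; apply: (@le_lt_trans _ _ ((S / m.+1%:R) ^+ d.+1)).
  rewrite -[d.+1 in leRHS]card_ord -prodr_const; apply: ler_prod => j _.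
  by rewrite normr_ge0 Sj.
rewrite exprn_ilt1 // ?divr_ge0 ?ler0n ?(ltW S0) //.
by rewrite ltr_pdivrMr // mul1r.
Qed.

(* Minkowski's theorem for boxes, with a non-optimal constant. *)
Lemma integral_in_box : exists2 C : R, 0 < C &
  forall r : 'I_d.+1 -> R, (forall j, 0 < r j) -> C < \prod_j r j ->
  exists g, [/\ integral g, g != 0 & forall j, `|sigma j g| < r j].
Proof.
have [S S0 Sbound] := conjugate_bound.
exists ((2 * S + 1) ^+ d.+1); first by rewrite exprn_gt0 // addr_gt0 // mulr_gt0.
move=> r r0 rC.
have rs0 : 0 <= \sum_j r j by apply: sumr_ge0 => j _; exact: ltW.
(* As [m] exceeds every [r j], the cell counts below satisfy
   [k j * r j <= 2 m S + r j <= (2 S + 1) m]. With the hypothesis on the product of the [r j], there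
   are fewer than [m ^+ d.+1] cells. *)
pose m := (Num.bound (\sum_j r j)).+1.
have rm j : r j <= m%:R.
  apply: (@le_trans _ _ (\sum_j r j)).
    by rewrite (bigD1 j) //= lerDl sumr_ge0 // => i _; exact: ltW.
  apply/ltW/(lt_trans (archi_boundP rs0)).
  by rewrite ltr_nat.
(* Combinations with coefficients in 0..m have conjugates in [-m S, m S]; shifted by m S and
   measured in units of [r j], these fall into [k j] cells. *)
pose k j := (Num.truncn (2 * m%:R * S / r j)).+1.
pose g (a : {ffun 'I_d.+1 -> 'I_m.+1}) := int_comb (fun i => (a i : int)).
have gS a j : `|sigma j (g a)| <= m%:R * S.
  rewrite /g int_combE; apply: Sbound => i.
  rewrite ger0_norm ?ler0n // rmorph_int ler_nat -ltnS.
  by rewrite ltn_ord.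
pose y a j := (sigma j (g a) + m%:R * S) / r j.
have y_ge0 a j : 0 <= y a j.
  rewrite divr_ge0 ?(ltW (r0 j)) // -lerBlDr sub0r.
  by have := gS a j; rewrite ler_norml => /andP[].
have y_lt a j : (Num.truncn (y a j) < k j)%N.
  rewrite ltnS le_truncn // ler_pM2r ?invr_gt0 //.
  have := gS a j; rewrite ler_norml => /andP[_].
  by lra.
pose box (a : {ffun 'I_d.+1 -> 'I_m.+1}) : {dffun forall j : 'I_d.+1, 'I_(k j)} :=
  [ffun j => Ordinal (y_lt a j)].
have [|a [b [ab boxab]]] := @pigeonhole _ _ box _.
  rewrite card_ffun !card_ord card_dep_ffun foldrE big_image /=.
  rewrite -(ltr_nat R) natr_prod.
  apply: (@lt_trans _ _ (m%:R ^+ d.+1)); last first.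
    by rewrite natrX ltrXn2r // ?ler0n // ltr_nat.
  have : \prod_(j < d.+1) (#|'I_(k j)|%:R * r j) <=
         \prod_(j < d.+1) ((2 * S + 1) * m%:R) :> R.
    apply: ler_prod => j _; rewrite mulr_ge0 ?ler0n ?(ltW (r0 j)) //=.
    rewrite card_ord /k -natr1 mulrDl mul1r.
    have u0 : 0 <= 2 * m%:R * S / r j.
      by rewrite divr_ge0 ?(ltW (r0 j)) // !mulr_ge0 ?ler0n ?(ltW S0).
    have /andP[u1 _] := truncn_itv u0.
    rewrite ler_pdivlMr // in u1.
    by have := rm j; lra.
  rewrite big_split prodr_const card_ord exprMn /= => h.
  have rp : 0 < \prod_j r j by apply: prodr_gt0.
  rewrite -(ltr_pM2r rp); apply: le_lt_trans h _.
  by rewrite mulrC ltr_pM2l // exprn_gt0 // ltr0n.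
exists (g a - g b); split.
- by apply: integral_sub; exact: integral_int_comb.
- rewrite subr_eq0; apply: contra ab => /eqP/int_comb_inj e.
  by apply/eqP/ffunP => i; apply/val_inj; case: (e i).
- move=> j; have := congr1 (fun f : {dffun forall j : 'I_d.+1, 'I_(k j)} => (f j : nat)) boxab.
  rewrite /= !ffunE /= => e.
  have /andP[a1 a2] := truncn_itv (y_ge0 a j).
  have /andP[b1 b2] := truncn_itv (y_ge0 b j).
  rewrite -e -natr1 in b1 b2; rewrite -natr1 in a2.
  rewrite rmorphB /=.
  have -> : sigma j (g a) - sigma j (g b) = (y a j - y b j) * r j.
    by rewrite /y mulrBl !divfK ?gt_eqF //; ring.
  rewrite normrM (gtr0_norm (r0 j)) -[ltRHS]mul1r ltr_pM2r //.
  by rewrite ltr_norml; lra.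
Qed.

(** * Total positivity at the embeddings, and residue classes of integers *)

Lemma totally_positiveP x : tp x <-> forall j, 0 < sigma j x.
Proof.
split=> [xtp j|xtp s]; first exact: xtp.
by have [j ->] := sigma_all s.
Qed.

Lemma natr_ext_neq0 n : (0 < n)%N -> n%:R != 0 :> K.
Proof.
by move=> n0; rewrite -(rmorph_nat (in_alg K)) fmorph_eq0 pnatr_eq0 -lt0n.
Qed.

Lemma natrM_int_comb (c : nat) (a : 'I_d.+1 -> int) :
  c%:R * int_comb a = int_comb (fun i => c%:Z * a i).
Proof.
by rewrite mulr_sumr; apply: eq_bigr => i _; rewrite mulrA rmorphM.
Qed.

Lemma integral_natrM n x : integral x -> integral (n%:R * x).
Proof. by move=> xint; apply: integral_mul => //; exact: integral_nat. Qed.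

(** For integral [x] the error in [norm_approximation] is an integer of norm below 1, hence zero, so
    [k x] lies in Z[t] for some [k <= M]; the factorial of [M] is a multiple of every such [k]. *)
Lemma integral_denominator : exists2 D, (0 < D)%N &
  forall x, integral x -> exists a : 'I_d.+1 -> int, D%:R * x = int_comb a.
Proof.
have [M M0 MP] := norm_approximation.
exists M`!; first exact: fact_gt0.
move=> x xint; have [k [a [/andP[k0 kM] ka]]] := MP x.
have kxa : k%:R * x = int_comb a.
  apply/eqP; rewrite -subr_eq0; apply: contraTT ka => nz.
  rewrite -leNgt; apply: embedding_norm_ge1 => //.
  by apply: integral_sub; [exact: integral_natrM|exact: integral_int_comb].
have /dvdnP[c ->] : (k %| M`!)%N by rewrite dvdn_fact // k0.
exists (fun i => c%:Z * a i).
by rewrite natrM -mulrA kxa natrM_int_comb.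
Qed.

(** The class of [x] records the coordinates of [D x] modulo [D k]. Equal classes give
    [D (x - y) = D k w] with [w] in Z[t], and [D] cancels. *)
Lemma finite_residues k : (0 < k)%N -> exists (T : finType) (cl : K -> T),
  forall x y, integral x -> integral y -> cl x = cl y ->
    exists2 w, integral w & x - y = k%:R * w.
Proof.
move=> k0; have [D D0 DP] := integral_denominator.
have /choice[a aE] : forall x, exists a : 'I_d.+1 -> int,
    integral x -> D%:R * x = int_comb a.
  move=> x; have [/DP[a aE]|nx] := pselect (integral x); first by exists a.
  by exists (fun=> 0) => /nx.
have Dk0 : (0 < D * k)%N by rewrite muln_gt0 D0.
exists {ffun 'I_d.+1 -> 'I_(D * k).-1.+1}.
exists (fun x => [ffun i => inord `|(a x i %% (D * k)%N)%Z|%N]).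
move=> x y xint yint cxy.
have cong i : (a x i = a y i %[mod (D * k)%N])%Z.
  have := congr1 (fun f : {ffun _ -> 'I_(D * k).-1.+1} => f i : nat) cxy.
  have Dkz : (D * k)%N%:Z != 0 by rewrite eqz_nat -lt0n.
  have lt u : (`|(u %% (D * k)%N)%Z| < (D * k).-1.+1)%N.
    by rewrite prednK // -ltz_nat gez0_abs ?modz_ge0 // ltz_pmod.
  rewrite /= !ffunE !inordK // => e.
  by rewrite -[LHS]gez0_abs ?modz_ge0 // e gez0_abs ?modz_ge0.
have /choice[c cE] : forall i, exists c : int, a x i - a y i = (D * k)%N%:Z * c.
  move=> i; have /eqP := cong i; rewrite eqz_mod_dvd => /dvdzP[c ->].
  by exists c; rewrite mulrC.
exists (int_comb c); first exact: integral_int_comb.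
apply: (mulfI (natr_ext_neq0 D0)); rewrite mulrA -natrM natrM_int_comb.
rewrite mulrBr !aE // -sumrB; apply: eq_bigr => i _.
by rewrite -mulrBl -rmorphB cE.
Qed.

(* If [n = N y] divides [k] and [x = y + k w], then
   [x / y = 1 + w (k / n) (n / y)], and [n / y] is a product of conjugates. *)
Lemma finite_integral_ratio (B : nat) : exists (T : finType) (cl : K -> T),
  forall x y, integral x -> integral y -> 0 < N y <= B%:R -> cl x = cl y ->
    integral (x / y).
Proof.
have [T [cl clP]] := finite_residues (fact_gt0 B).
exists T, cl => x y xint yint /andP[y0 yB] /(clP _ _ xint yint)[w wint xyE].
have ynz : y != 0 by rewrite -embedding_norm_eq0 gt_eqF.
have [z zE] := embedding_norm_int yint.
move: y0 yB; rewrite zE ltr0z => z0; case: z zE z0 => // n nE n0.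
rewrite -[n%:~R]/(n%:R) ler_nat => nB.
have /dvdnP[c cE] : (n %| B`!)%N by rewrite dvdn_fact // nB andbT.
have -> : x / y = 1 + w * (c%:R * (n%:R / y)).
  rewrite -[x](subrK y) xyE mulrDl divff // addrC cE natrM.
  by congr (1 + _); ring.
apply: integral_add; first exact: integral1.
apply: integral_mul => //; apply: integral_natrM.
exact: (integral_norm_div yint ynz nE).
Qed.

(** * Denominators uniform over all fractional ideals *)

Lemma common_denominator : exists2 M, (0 < M)%N &
  forall I : set K, nonzero_fractional_ideal I ->
  exists b, [/\ I b, b != 0 & forall x, I x -> integral (M%:R * x / b)].
Proof.
have [M M0 MP] := norm_approximation.
exists M`!; first exact: fact_gt0.
move=> I [[I0 ID IM [e [eint e0 eI]]] [x0 Ix0 x0nz]].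
(* Scaling by the denominator [e] of [I] makes these norms natural numbers, so a least one
   exists. *)
pose P n := `[< exists b, [/\ I b, b != 0 & `|N (e * b)| = n%:R] >].
have PI b : I b -> b != 0 -> exists2 n, P n & `|N (e * b)| = n%:R.
  move=> Ib b0; have [z zE] := embedding_norm_int (eI b Ib).
  have zE' : `|N (e * b)| = `|z|%N%:R by rewrite zE -intr_norm -abszE.
  by exists `|z|%N => //; apply/asboolP; exists b.
have exP : exists n, P n by have [n Pn _] := PI _ Ix0 x0nz; exists n.
case: (ex_minnP exP) => n /asboolP[b [Ib b0 bn]] nmin.
exists b; split=> // x Ix.
have [k [a [/andP[k0 kM] ka]]] := MP (x / b).
(* The remainder of [k x] on division by [b]. It lies in [I] and, if nonzero, would contradict the
   minimality of [b]. *)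
pose y := k%:R * x + (- int_comb a) * b.
have Iy : I y.
  by apply: ID; apply: IM => //; [exact: integral_nat|apply: integral_opp; exact: integral_int_comb].
have yE : y = (k%:R * (x / b) - int_comb a) * b.
  by rewrite /y mulNr mulrBl -mulrA divfK.
have y0 : y = 0.
  apply/eqP/negP => /negP ynz; have [n' Pn' n'E] := PI _ Iy ynz.
  have := nmin _ Pn'; rewrite -(ler_nat R) -n'E -bn leNgt => /negP; apply.
  rewrite yE mulrCA [N (_ * (e * b))]embedding_normM normrM gtr_pMl // normr_gt0 embedding_norm_eq0.
  by rewrite mulf_neq0.
have /dvdnP[c ->] : (k %| M`!)%N by rewrite dvdn_fact // k0.
have <- : c%:R * int_comb a = (c * k)%:R * x / b.
  move/eqP: y0; rewrite yE mulf_eq0 (negPf b0) orbF subr_eq0 => /eqP <-.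
  by rewrite natrM !mulrA.
by apply: integral_natrM; exact: integral_int_comb.
Qed.

(** One integer [w] is fixed for each sign pattern realized by a nonzero integer. The pattern of [b]
    is realized by [e ^+ 2 * b], so the matching [w] makes [w * b] totally positive, at the cost of
    a factor [c] with [c / w] integral. *)
Lemma totally_positive_common_denominator : exists2 M, (0 < M)%N &
  forall I : set K, nonzero_fractional_ideal I ->
  exists b, [/\ I b, tp b & forall x, I x -> integral (M%:R * x / b)].
Proof.
have [M M0 MP] := common_denominator.
pose sg x : {ffun 'I_d.+1 -> bool} := [ffun j => 0 < sigma j x].
have /choice[del delP] : forall e, exists w : K * nat,
    [/\ integral w.1 /\ w.1 != 0, (0 < w.2)%N /\ integral (w.2%:R / w.1)
      & forall x, integral x -> x != 0 -> sg x = e -> sg w.1 = e].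
  move=> e.
  suff [w [wint w0 we]] : exists w, [/\ integral w, w != 0 &
      forall x, integral x -> x != 0 -> sg x = e -> sg w = e].
    (* The natural number paired with [w] is the absolute value of its norm. *)
    have [z zE] := embedding_norm_int wint.
    have zint := integral_norm_div wint w0 zE.
    have z0 : z != 0 by rewrite -embedding_norm_eq0 zE intr_eq0 in w0.
    exists (w, `|z|%N); split => //; split; first by rewrite absz_gt0.
    rewrite -[_%:R]/(`|z|%N%:~R) abszE /=; have [z_ge0|z_lt0] := lerP 0 z.
      by rewrite ger0_norm.
    by rewrite ltr0_norm // mulrNz mulNr; exact: integral_opp.
  have [[w [wint w0 we]]|no] :=
      pselect (exists w, [/\ integral w, w != 0 & sg w = e]).
    by exists w; split.
  (* A default for patterns that no nonzero integer has; the last condition is then vacuous. *)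
  exists 1; split; [exact: integral1|exact: oner_neq0|].
  by move=> x xint x0 xe; case: no; exists x.
(* A multiple of the factor of every pattern, hence independent of the ideal. *)
pose P := (\prod_e (del e).2)%N.
exists (M * P)%N.
  by rewrite muln_gt0 M0 prodn_gt0 // => e; have [_ []] := delP e.
move=> I Inz; have [b [Ib b0 bM]] := MP I Inz.
have [[_ _ IM [e [eint e0 eI]]] _] := Inz.
have eebint : integral (e * (e * b)) by apply: integral_mul => //; exact: eI.
have eeb0 : e * (e * b) != 0 by rewrite !mulf_neq0.
pose s0 := sg (e * (e * b)).
have [[wint w0] [_ cint] /(_ _ eebint eeb0 erefl) wP] := delP s0.
have /dvdnP[q PE] : ((del s0).2 %| P)%N by rewrite /P (bigD1 s0) //= dvdn_mulr.
move: (del s0) wint w0 cint wP PE => [w c] /= wint w0 cint wP PE.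
exists (w * b); split; first exact: IM.
- apply/totally_positiveP => j.
  have := congr1 (fun f : {ffun 'I_d.+1 -> bool} => f j) wP.
  rewrite /= !ffunE mulrA !rmorphM -expr2 pmulr_rgt0; last first.
    by rewrite lt0r sqr_ge0 sqrf_eq0 fmorph_eq0 e0.
  have /lt_total : sigma j w != 0 by rewrite fmorph_eq0.
  have /lt_total : sigma j b != 0 by rewrite fmorph_eq0.
  case/orP => bs; case/orP => ws; rewrite ?bs ?ws ?(lt_gtF bs) ?(lt_gtF ws) //= => _.
    by rewrite nmulr_rgt0.
  by rewrite mulr_gt0.
- move=> x Ix.
  have -> : (M * P)%:R * x / (w * b) = q%:R * (c%:R / w) * (M%:R * x / b).
    by rewrite PE !natrM invfM; ring.
  by apply: integral_mul; [exact: integral_natrM|exact: bM].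
Qed.

(** * Squares below totally positive elements, and descent on the norm *)

Lemma integral_square_below : exists2 C : R, 0 < C &
  forall x, tp x -> C < N x ->
  exists g, [/\ integral g, g != 0 & forall j, sigma j (g ^+ 2) < sigma j x].
Proof.
have [C C0 CP] := integral_in_box.
(* The box has sides the square roots of the conjugates of [x], with product the square root of
   [N x]; hence the squared constant. *)
exists (C ^+ 2); first exact: exprn_gt0.
move=> x xtp xC.
have [||g [gint g0 gx]] := CP (fun j => Num.sqrt (sigma j x)).
- by move=> j; rewrite sqrtr_gt0; exact: xtp.
- rewrite -(ltr_pXn2r (n := 2)) ?nnegrE ?(ltW C0) //; last first.
    by apply: prodr_ge0 => j _; exact: sqrtr_ge0.
  rewrite -prodrXl (lt_le_trans xC) // le_eqVlt; apply/orP; left; apply/eqP.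
  by apply: eq_bigr => j _; rewrite sqr_sqrtr // ltW // xtp.
- exists g; split=> // j.
  have xj0 : 0 <= sigma j x by apply: ltW.
  rewrite rmorphXn -[ltRHS](sqr_sqrtr xj0) -[ltLHS]real_normK ?num_real //.
  by rewrite ltr_pXn2r ?nnegrE ?sqrtr_ge0.
Qed.

Lemma totally_positiveD x y : tp x -> tp y -> tp (x + y).
Proof. by move=> xtp ytp s; rewrite rmorphD addr_gt0. Qed.

Lemma totally_positiveM x y : tp x -> tp y -> tp (x * y).
Proof. by move=> xtp ytp s; rewrite rmorphM mulr_gt0. Qed.

Lemma totally_positive_div x y : tp x -> tp y -> tp (x / y).
Proof. by move=> xtp ytp s; rewrite fmorph_div divr_gt0. Qed.

Lemma totally_positive_nat n : (0 < n)%N -> tp n%:R.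
Proof. by move=> n0 s; rewrite rmorph_nat ltr0n. Qed.

Lemma totally_positive_sqr x : x != 0 -> tp (x ^+ 2).
Proof. by move=> x0 s; rewrite rmorphXn lt0r sqr_ge0 sqrf_eq0 fmorph_eq0 x0. Qed.

Lemma totally_positive_neq0 x : tp x -> x != 0.
Proof. by move=> /totally_positiveP/(_ ord0); apply: contraTneq => ->; rewrite rmorph0 ltxx. Qed.

Lemma embedding_norm_totally_positive x : tp x -> 0 < N x.
Proof. by move=> xtp; apply: prodr_gt0 => j _. Qed.

Lemma embedding_norm_lt x y : tp x -> tp (y - x) -> N x < N y.
Proof.
move=> xtp yxtp; apply: ltr_prod.
  by apply/hasP; exists ord0; rewrite ?mem_index_enum.
by move=> j _; rewrite (ltW (xtp _)) -subr_gt0 -rmorphB yxtp.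
Qed.

Lemma pos0_partD (J : set K) x y : (forall x y, J x -> J y -> J (x + y)) ->
  pos0_part R J x -> pos0_part R J y -> pos0_part R J (x + y).
Proof.
move=> JD [[Jx xtp]|->]; last by rewrite add0r.
case=> [[Jy ytp]|->]; last by rewrite addr0; left.
by left; split; [exact: JD|exact: totally_positiveD].
Qed.

(* Subtracting [b g ^+ 2] from [x], for a small [g], keeps [x] totally positive
   and lowers the norm of the integer [M x / b]. *)
Lemma bounded_norm_remainder (M : nat) : (0 < M)%N -> exists B : nat,
  forall (I : set K) b, fractional_ideal I -> I b -> tp b ->
    (forall x, I x -> integral (M%:R * x / b)) ->
  forall x, I x -> tp x -> exists u x',
    [/\ pos0_part R (@ring_of_integers K) u, I x', tp x', x = b * u + x'
      & N (M%:R * x' / b) <= B%:R].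
Proof.
move=> M0; have [C C0 CP] := integral_square_below.
(* Since the norm of [M] is [M ^+ d.+1], a norm of [M x / b] above [CM] means [N (x / b) > C]. *)
pose CM := C * M%:R ^+ d.+1.
have CM0 : 0 <= CM by rewrite mulr_ge0 ?(ltW C0) // exprn_ge0 // ler0n.
exists (Num.bound CM) => I b [_ ID IM _] Ib btp bM x.
(* Induction on the truncated norm: the norms are positive integers, so a strict decrease lowers the
   truncation. *)
have [n] := ubnP (Num.truncn (N (M%:R * x / b))).
elim: n x => // n IHn x xn Ix xtp.
have [small|large] := lerP (N (M%:R * x / b)) (Num.bound CM)%:R.
  by exists 0, x; rewrite mulr0 add0r; split => //; right.
have xbtp : tp (x / b) by exact: totally_positive_div.
have [|g [gint g0 gx]] := CP _ xbtp.
  rewrite -(@ltr_pM2r _ (M%:R ^+ d.+1)) ?exprn_gt0 ?ltr0n //.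
  have := lt_trans (archi_boundP CM0) large.
  by rewrite -mulrA embedding_normM embedding_norm_nat mulrC.
pose x1 := x - b * g ^+ 2.
have g2int : integral (g ^+ 2) by exact: integral_exp.
have Ix1 : I x1.
  rewrite /x1 -mulrN mulrC; apply: ID => //.
  by apply: IM => //; exact: integral_opp.
have x1tp : tp x1.
  have -> : x1 = b * (x / b - g ^+ 2).
    by rewrite mulrBr mulrCA divff ?mulr1 // totally_positive_neq0.
  apply: totally_positiveM => //; apply/totally_positiveP => j.
  by rewrite rmorphB subr_gt0.
have Mtp : tp M%:R by exact: totally_positive_nat.
have z1tp : tp (M%:R * x1 / b).
  by apply: totally_positive_div => //; exact: totally_positiveM.
have lt1 : N (M%:R * x1 / b) < N (M%:R * x / b).
  apply: embedding_norm_lt => //.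
  have -> : M%:R * x / b - M%:R * x1 / b = M%:R * g ^+ 2.
    rewrite -mulrBl -mulrBr /x1 opprB addrC subrK mulrCA mulrAC divff ?mul1r //.
    exact: totally_positive_neq0.
  by apply: totally_positiveM => //; exact: totally_positive_sqr.
have [|u [x' [uO Ix' x'tp x1E x'B]]] := IHn x1 _ Ix1 x1tp.
  rewrite ltnS in xn; apply: leq_trans xn.
  have [z1 z1E] := embedding_norm_int (bM _ Ix1).
  have [z zE] := embedding_norm_int (bM _ Ix).
  have z1_gt0 := embedding_norm_totally_positive z1tp.
  move: lt1 z1_gt0; rewrite z1E zE ltr_int ltr0z.
  case: z1 {z1E} => // n1; case: z {zE} => // n2 lt12 _.
  by rewrite -![_%:~R]/(_%:R) !natrK.
exists (g ^+ 2 + u), x'; split => //.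
  apply: pos0_partD => //; first by move=> y z; exact: integral_add.
  by left; split => //; exact: totally_positive_sqr.
by rewrite mulrDr -addrA -x1E /x1 addrC subrK.
Qed.

(** * Generators, in a number independent of the ideal *)

Lemma pos0_span_sub (I : set K) n (alpha : 'I_n -> K) : fractional_ideal I ->
    (forall i, pos_part R I (alpha i)) ->
  (pos0_span R alpha `<=` pos0_part R I)%classic.
Proof.
move=> [_ ID IM _] Ialpha _ [g [gO ->]].
apply: big_ind => [|x y|i _]; [by right|exact: pos0_partD|].
have [Ia atp] := Ialpha i; case: (gO i) => [[gint gtp]|->]; last first.
  by right; rewrite /= mulr0.
by left; split; [rewrite mulrC; exact: IM|exact: totally_positiveM].
Qed.

Lemma uniformly_generated : exists n, forall I : set K,
  nonzero_fractional_ideal I -> pos0_generated_by R I n.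
Proof.
have [M M0 MP] := totally_positive_common_denominator.
have [B BP] := bounded_norm_remainder M0.
have [T [cl clP]] := finite_integral_ratio B.
(* [None] indexes the generator [b] and [Some c] the representative of class [c]; [T] is fixed
   before [I]. *)
exists #|{: option T}| => I Inz.
have [b [Ib btp bM]] := MP I Inz; have [Ifrac _] := Inz.
pose z x := M%:R * x / b.
have /choice[a aP] : forall c, exists a, [/\ I a, tp a &
    forall x, I x -> tp x -> N (z x) <= B%:R -> cl (z x) = c ->
      N (z a) <= B%:R /\ cl (z a) = c].
  move=> c; have [[a [Ia atp aB ac]]|no] := pselect (exists a,
      [/\ I a, tp a, N (z a) <= B%:R & cl (z a) = c]).
    by exists a; split.
  (* An empty class gets [b] as its representative, which keeps the number of generators the same
     for every ideal. *)
  by exists b; split=> // x Ix xtp xB xc; case: no; exists x.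
pose alpha (o : option T) := if o is Some c then a c else b.
have alphaP o : pos_part R I (alpha o).
  by case: o => [c|] //=; have [] := aP c.
exists (fun i => alpha (enum_val i)); split.
  by move=> i; split => //; have [] := alphaP (enum_val i).
apply/seteqP; split; last by apply: pos0_span_sub => // i; exact: alphaP.
move=> x [[Ix xtp]|->]; last first.
  exists (fun=> 0); split=> [i|]; first by right.
  by rewrite big1 // => i _; rewrite mulr0.
have [u [x' [uO Ix' x'tp xE x'B]]] := BP I b Ifrac Ib btp bM x Ix xtp.
pose c := cl (z x'); have [Ia atp /(_ _ Ix' x'tp x'B erefl)[aB ac]] := aP c.
pose y := x' / a c.
have yO : pos0_part R (@ring_of_integers K) y.
  left; split; last exact: totally_positive_div.
  (* The common factor M / b cancels, so [y] is a ratio of two integers of norm at most [B] in the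
     same class. *)
  have -> : y = z x' / z (a c).
    have a0 := totally_positive_neq0 atp; have b0 := totally_positive_neq0 btp.
    have M0' := natr_ext_neq0 M0.
    by rewrite /y /z; field; rewrite a0 b0 M0'.
  apply: clP; [exact: bM|exact: bM| |by rewrite ac].
  rewrite aB embedding_norm_totally_positive //; apply: totally_positive_div => //.
  by apply: totally_positiveM => //; exact: totally_positive_nat.
pose G (o : option T) := if o is Some c' then (if c' == c then y else 0) else u.
exists (fun i => G (enum_val i)); split.
  by move=> i; case: (enum_val i) => [c'|] //=; case: ifP => // _; right.
rewrite -(big_enum_val (fun o => alpha o * G o)) /=.
rewrite (bigD1 None) //= (bigD1 (Some c)) //= big1 => [|[c'|] // /andP[_]].
  rewrite addr0 eqxx /y mulrCA divff ?mulr1 //.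
  exact: totally_positive_neq0.
by rewrite (inj_eq Some_inj) /= => /negPf ->; rewrite mulr0.
Qed.

End TotallyRealField.

(** * Finiteness of the supremum *)

Lemma ring_of_integers_fractional (K : fieldExtType rat) :
  nonzero_fractional_ideal (@ring_of_integers K).
Proof.
split; last by exists 1; [exact: integral1|exact: oner_neq0].
split; [exact: integral0|by move=> x y; exact: integral_add|by move=> x y; exact: integral_mul|].
by exists 1; split; [exact: integral1|exact: oner_neq0|move=> x; rewrite mul1r].
Qed.

Theorem theorem3p6 (R : realType) (K : fieldExtType rat)
    (K_totally_real : totally_real R K) :
  kappa_field R K \is a fin_num.
Proof.
have [d [t [sigma [t_int t_gen sigma_inj sigma_all]]]] := real_embeddings K_totally_real.
have [n nP] := uniformly_generated t_int t_gen sigma_inj sigma_all.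
(* The ideal [ring_of_integers] contributes a nonnegative value, so the supremum is not -oo; the
   uniform [n] excludes +oo. *)
rewrite fin_real //; apply/andP; split.
  apply: (@lt_le_trans _ _ 0%E) => //.
  apply: (@le_trans _ _ (kappa R (@ring_of_integers K))).
    by apply: le_ereal_inf_tmp => _ [m _ <-]; rewrite lee_fin ler0n.
  apply: ereal_sup_ubound; exists (@ring_of_integers K) => //.
  exact: ring_of_integers_fractional.
apply: (@le_lt_trans _ _ (n%:R)%:E); last exact: ltry.
apply: ge_ereal_sup => _ [I Inz <-].
by apply: ereal_inf_lbound; exists n => //; exact: nP.
Qed.
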